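(* Let $d\ge2$ and let $\mathcal{H}_A,\mathcal{H}_B$ be $d$-dimensional complex Hilbert spaces. Let $\mathbb{P}_{A}=\{\mathcal{P}_{A}^{(1)},\ldots,\mathcal{P}_{A}^{(M)}\}$ be a set of $M$ mutually unbiased measurements of efficiency $\varkappa_{A}$ on $\mathcal{H}_{A}$, and let $\mathbb{Q}_{B}=\{\mathcal{Q}_{B}^{(1)},\ldots,\mathcal{Q}_{B}^{(M)}\}$ be a set of $M$ mutually unbiased measurements of efficiency $\varkappa_{B}$ on $\mathcal{H}_{B}$. Then for all density matrices $\rho_A$ on $\mathcal{H}_A$ and $\rho_B$ on $\mathcal{H}_B$, the correlation measure $J_M$ satisfies $$J_{M}(\rho_{A}\otimes\rho_{B})\;\leq\;\prod_{S=A,B}\left(\frac{M(d-1)+(\varkappa_{S}d-1)\bigl(\mathrm{Tr}(\rho_{S}^{2})d-1\bigr)}{d(d-1)}\right)^{1/2}.$$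
   Context: A density matrix is a positive semidefinite operator of trace one. A POVM with $d$ elements on a $d$-dimensional Hilbert space is a family of positive semidefinite operators $\{P_n\}_{n=1}^d$ with $\sum_n P_n=I$ (the identity). A set $\{\mathcal{P}^{(1)},\ldots,\mathcal{P}^{(M)}\}$ of POVMs $\mathcal{P}^{(b)}=\{P^{(b)}_n\}_{n=1}^d$, each with $d$ elements (an indexed family, $b=1,\dots,M$), on a $d$-dimensional Hilbert space is a set of $M$ mutually unbiased measurements (MUMs) of efficiency $\varkappa$ if: (i) $\mathrm{Tr}(P^{(b)}_n)=1$ for all $b,n$; (ii) $\mathrm{Tr}(P^{(a)}_mP^{(b)}_n)=\frac1d$ for all $a\neq b$ and all $m,n$; (iii) for all $b,m,n$, $\mathrm{Tr}(P^{(b)}_mP^{(b)}_n)=\delta_{mn}\,\varkappa+(1-\delta_{mn})\frac{1-\varkappa}{d-1}$. Here $\varkappa$ is a real parameter, for which $1/d\le\varkappa\le 1$. Write $\mathcal{P}_A^{(b)}=\{P_n^{(b)}\}_{n=1}^d$ and $\mathcal{Q}_B^{(b)}=\{Q_n^{(b)}\}_{n=1}^d$. For a density matrix $\tilde\rho_{AB}$ on $\mathcal{H}_A\otimes\mathcal{H}_B$, put $P^{(b)}(m,n)=\mathrm{Tr}\bigl((P_m^{(b)}\otimes Q_n^{(b)})\tilde\rho_{AB}\bigr)$, and define the correlation measure $$J_M(\tilde\rho_{AB})=\sum_{b=1}^M\sum_{n=1}^d P^{(b)}(n,n).$$ *)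

(* Defs.v *)
From mathcomp Require Import all_boot all_order all_algebra.
From mathcomp Require Import reals.
From mathcomp Require Export complex mxtens.

Set Implicit Arguments.
Unset Strict Implicit.
Unset Printing Implicit Defensive.

Import Order.TTheory GRing.Theory Num.Theory.
Local Open Scope ring_scope.
Local Open Scope complex_scope.

(* Operators on the d-dimensional Hilbert space C^d are d x d matrices acting
   on column vectors.  On R[i] the order is partial, with x <= y iff y - x is a
   nonnegative real, so [0 <= _] below also asserts that the value is real. *)
Definition psdmx (R : realType) (n : nat) (A : 'M[R[i]]_n) : Prop :=
  A \is hermsymmx /\
  forall v : 'cV[R[i]]_n, 0 <= (map_mx Num.conj v^T *m A *m v) 0 0.

Definition density_matrix (R : realType) (n : nat) (rho : 'M[R[i]]_n) : Prop :=
  psdmx rho /\ \tr rho = 1.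

Definition povm (R : realType) (d : nat) (P : 'I_d -> 'M[R[i]]_d) : Prop :=
  (forall n, psdmx (P n)) /\ \sum_n P n = 1%:M.

(* For 1 < d the range of kappa follows from the other conditions when 0 < M;
   it is a genuine constraint only for the empty family. *)
Record mutually_unbiased_measurements (R : realType) (d M : nat) (kappa : R)
    (P : 'I_M -> 'I_d -> 'M[R[i]]_d) : Prop := MUM {
  mum_povm : forall b, povm (P b);
  mum_efficiency_range : d%:R^-1 <= kappa <= 1;
  mum_trace : forall b n, \tr (P b n) = 1;
  mum_unbiased : forall a b m n, a != b ->
    \tr (P a m *m P b n) = d%:R^-1;
  mum_efficiency : forall b m n,
    \tr (P b m *m P b n) =
      ((m == n)%:R * kappa + (1 - (m == n)%:R) * ((1 - kappa) / (d%:R - 1)))%:C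
}.

(* [A *t B] is the Kronecker product, so that C^d (x) C^d is C^(d * d). *)
Definition joint_probability (R : realType) (d M : nat)
    (P Q : 'I_M -> 'I_d -> 'M[R[i]]_d) (rho : 'M[R[i]]_(d * d))
    (b : 'I_M) (m n : 'I_d) : R[i] :=
  \tr ((P b m *t Q b n) *m rho).

Definition correlation_measure (R : realType) (d M : nat)
    (P Q : 'I_M -> 'I_d -> 'M[R[i]]_d) (rho : 'M[R[i]]_(d * d)) : R[i] :=
  \sum_(b < M) \sum_(n < d) joint_probability P Q rho b n n.

(* Main.v *)
(** For a product state [J_M = \sum_(b, n) p_bn q_bn] with
    [p_bn = Tr (P_bn rhoA)] and [q_bn = Tr (Q_bn rhoB)], so by Cauchy-Schwarz
    it suffices to bound [\sum_(b, n) p_bn ^ 2].  The traceless parts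
    [F_bn = P_bn - I / d] are orthogonal for different [b], and inside one
    measurement their Gram matrix acts as the scalar [(kappa d - 1) / (d - 1)]
    on vectors with zero sum, such as [n |-> p_bn - 1 / d].  A Bessel inequality
    for [rho - I / d] against the [F_bn] then gives the bound. *)
Require Import Defs.
From mathcomp Require Import all_boot all_order all_algebra.
From mathcomp Require Import reals ring.

Import Order.TTheory GRing.Theory Num.Theory.
Local Open Scope ring_scope.
Local Open Scope complex_scope.

Lemma mxtrace_tens (S : comPzRingType) m n (A : 'M[S]_m) (B : 'M[S]_n) :
  \tr (A *t B) = \tr A * \tr B.
Proof.
rewrite /mxtrace mulr_suml (reindex (@mxtens_index m n)) /=; last first.
  by exists (@mxtens_unindex m n) => i _;
    rewrite (mxtens_indexK, mxtens_unindexK).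
under [RHS]eq_bigr do rewrite mulr_sumr.
by rewrite pair_bigA; apply: eq_bigr => -[i j] _; rewrite tensmxE.
Qed.

Section HilbertSchmidt.
Variable C : numClosedFieldType.

Lemma dotmx_mxvec m n (A B : 'M[C]_(m, n)) :
  dotmx (mxvec A) (mxvec B) = \sum_i \sum_j A i j * Num.conj (B i j).
Proof.
rewrite dotmxE mxE pair_bigA (reindex _ (curry_mxvec_bij m n)) /=.
by apply: eq_bigr => -[i j] _ /=; rewrite !mxE !mxvecE.
Qed.

Lemma hermsymmxP n (A : 'M[C]_n) :
  reflect (forall i j, A i j = Num.conj (A j i)) (A \is hermsymmx).
Proof.
apply: (iffP (is_hermitianmxP _ _ _)); rewrite expr0 scale1r.
  by move=> {1}-> i j; rewrite !mxE.
by move=> hA; apply/matrixP => i j; rewrite !mxE.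
Qed.

(** Flattening turns the trace form into the Hermitian inner product of row vectors, so
    Cauchy-Schwarz becomes available for traces. *)
Lemma dotmx_mxvec_herm n (A B : 'M[C]_n) : B \is hermsymmx ->
  dotmx (mxvec A) (mxvec B) = \tr (A *m B).
Proof.
move=> /hermsymmxP hB; rewrite dotmx_mxvec; apply: eq_bigr => i _.
by rewrite mxE; apply: eq_bigr => j _; rewrite [B j i]hB.
Qed.

Lemma mxtrace_herm_real n (A B : 'M[C]_n) :
  A \is hermsymmx -> B \is hermsymmx -> \tr (A *m B) \is Num.real.
Proof.
move=> /hermsymmxP hA /hermsymmxP hB; apply/CrealP.
rewrite {2}mxtrace_mulC /mxtrace rmorph_sum; apply: eq_bigr => i _.
rewrite !mxE rmorph_sum; apply: eq_bigr => j _.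
by rewrite rmorphM mulrC /= -hA -hB.
Qed.

Lemma mxtrace_herm_sqr_ge0 n (A : 'M[C]_n) :
  A \is hermsymmx -> 0 <= \tr (A *m A).
Proof. by move=> hA; rewrite -dotmx_mxvec_herm // dnorm_ge0. Qed.

Lemma hermsymmx_sum_real n (I : finType) (c : I -> C) (F : I -> 'M[C]_n) :
  (forall i, c i \is Num.real) -> (forall i, F i \is hermsymmx) ->
  \sum_i c i *: F i \is hermsymmx.
Proof.
move=> cR hF; apply/hermsymmxP => j k; rewrite !summxE rmorph_sum.
apply: eq_bigr => i _; rewrite !mxE rmorphM /=.
by rewrite (CrealP (cR i)) [F i j k](hermsymmxP _ _ (hF i)).
Qed.

Lemma hermsymmx_sub_scalar n (A : 'M[C]_n) (a : C) :
  a \is Num.real -> A \is hermsymmx -> A - a%:M \is hermsymmx.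
Proof.
move=> aR /hermsymmxP hA; apply/hermsymmxP => i j.
by rewrite !mxE rmorphB rmorphMn /= (CrealP aR) -hA eq_sym.
Qed.

(** The hypothesis makes the coefficient vector [c i = \tr (F i *m D)] an eigenvector of the Gram
    matrix. With [T = \sum_i c i *: F i] and [N = \sum_i c i ^+ 2] this gives [\tr (T *m D) = N] and
    [\tr (T *m T) = lambda * N]; Cauchy-Schwarz for [T] and [D] then yields the bound after division
    by [N]. *)
Lemma bessel_gram_eigenvector n (I : finType) (D : 'M[C]_n)
    (F : I -> 'M[C]_n) (lambda : C) :
  0 <= lambda -> D \is hermsymmx -> (forall i, F i \is hermsymmx) ->
  (forall i, \sum_j \tr (F j *m D) * \tr (F i *m F j)
             = lambda * \tr (F i *m D)) ->
  \sum_i \tr (F i *m D) ^+ 2 <= lambda * \tr (D *m D).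
Proof.
move=> l_ge0 hD hF gram; pose c i := \tr (F i *m D).
have cR i : c i \is Num.real by exact: mxtrace_herm_real.
pose T := \sum_i c i *: F i.
have hT : T \is hermsymmx by exact: hermsymmx_sum_real.
pose N := \sum_i c i ^+ 2; rewrite -/N.
have TD : \tr (T *m D) = N.
  rewrite mulmx_suml raddf_sum; apply: eq_bigr => i _ /=.
  by rewrite -scalemxAl mxtraceZ -expr2.
have TT : \tr (T *m T) = lambda * N.
  rewrite {1}/T mulmx_suml raddf_sum mulr_sumr; apply: eq_bigr => i _ /=.
  rewrite -scalemxAl mxtraceZ expr2 mulrCA -gram; congr (_ * _).
  rewrite mulmx_sumr raddf_sum; apply: eq_bigr => j _ /=.
  by rewrite -scalemxAr mxtraceZ.
have N_ge0 : 0 <= N by apply: sumr_ge0 => i _; rewrite -realEsqr.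
have : `|dotmx (mxvec T) (mxvec D)| ^+ 2
    <= dotmx (mxvec T) (mxvec T) * dotmx (mxvec D) (mxvec D).
  exact: (CauchySchwarz _ _ _).1.
rewrite !dotmx_mxvec_herm // TD TT ger0_norm // mulrAC expr2.
have [-> _|N_neq0] := eqVneq N 0.
  by rewrite mulr_ge0 // mxtrace_herm_sqr_ge0.
by rewrite ler_pM2r // lt_def N_neq0.
Qed.

End HilbertSchmidt.

Lemma mum_index_of_coincidence (R : realType) (d M : nat) (kappa : R)
    (P : 'I_M -> 'I_d -> 'M[R[i]]_d) (rho : 'M[R[i]]_d) :
  (2 <= d)%N -> mutually_unbiased_measurements kappa P ->
  density_matrix rho ->
  \sum_b \sum_n \tr (P b n *m rho) ^+ 2 <=
    (M%:R * (d%:R - 1)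
     + (kappa%:C * d%:R - 1) * (\tr (rho *m rho) * d%:R - 1))
    / (d%:R * (d%:R - 1)).
Proof.
move=> d_gt1 [povmP rk trP unb eff] [[hrho _] trrho].
have d0 : d%:R != 0 :> R[i] by rewrite pnatr_eq0 -lt0n ltnW.
have d1 : d%:R - 1 != 0 :> R[i].
  by rewrite subr_eq0 -[1]/(1%:R) eqr_nat gtn_eqF.
pose F (i : 'I_M * 'I_d) := P i.1 i.2 - (d%:R^-1)%:M : 'M[R[i]]_d.
pose D := rho - (d%:R^-1)%:M : 'M[R[i]]_d.
pose lambda : R[i] := (kappa%:C * d%:R - 1) / (d%:R - 1).
(* Both cross terms give [- 1 / d] and the scalar part gives [d / d ^ 2], a net loss of [1 / d]. *)
have trM (A B : 'M[R[i]]_d) : \tr A = 1 -> \tr B = 1 ->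
    \tr ((A - (d%:R^-1)%:M) *m (B - (d%:R^-1)%:M)) = \tr (A *m B) - d%:R^-1.
  move=> trA trB; rewrite mulmxBl !mulmxBr mul_mx_scalar !mul_scalar_mx.
  rewrite !raddfB /= !mxtraceZ mxtrace_scalar trA trB -mulr_natr; field.
  exact: d0.
have dR : d%:R^-1 \is @Num.real R[i] by rewrite rpredV realn.
have hF i : F i \is hermsymmx.
  by apply: hermsymmx_sub_scalar => //; have [/(_ i.2)[]] := povmP i.1.
have hD : D \is hermsymmx by exact: hermsymmx_sub_scalar.
have FD i : \tr (F i *m D) = \tr (P i.1 i.2 *m rho) - d%:R^-1 by exact: trM.
have FF i j : \tr (F i *m F j) = \tr (P i.1 i.2 *m P j.1 j.2) - d%:R^-1.
  exact: trM.
have sum1 b : \sum_n \tr (P b n *m rho) = 1.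
  by rewrite -raddf_sum -mulmx_suml (povmP b).2 mul1mx.
have sumFD b : \sum_n \tr (F (b, n) *m D) = 0.
  under eq_bigr do rewrite FD; rewrite sumrB sum1 sumr_const card_ord.
  by rewrite -[_ *+ d]mulr_natr mulVf // subrr.
(* Within one measurement the Gram matrix is [lambda] times the identity plus a constant matrix; the
   latter kills zero-sum vectors. *)
have effC b m n : \tr (F (b, m) *m F (b, n))
    = (m == n)%:R * lambda + ((1 - kappa%:C) / (d%:R - 1) - d%:R^-1).
  rewrite FF eff /lambda rmorphD !rmorphM !rmorphB /= fmorphV !rmorphB /=.
  rewrite !rmorph_nat rmorph1; field; exact/andP.
(* This is the bound [1 / d <= kappa]. *)
have l_ge0 : 0 <= lambda.
  rewrite divr_ge0 // ?subr_ge0 ?ler1n 1?ltnW //.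
  rewrite -ler_pdivrMr ?ltr0n 1?ltnW // mul1r -(rmorph_nat (real_complex R)).
  by rewrite -fmorphV lecR; case/andP: rk.
have gram i : \sum_j \tr (F j *m D) * \tr (F i *m F j)
             = lambda * \tr (F i *m D).
  case: i => b n; rewrite -(pair_bigA _ (fun a m =>
    \tr (F (a, m) *m D) * \tr (F (b, n) *m F (a, m)))) /=.
  (* Different measurements contribute nothing: unbiasedness makes their centred elements
     orthogonal. *)
  rewrite (bigD1 b) //= [X in _ + X]big1 ?addr0 => [|a ab]; last first.
    by apply: big1 => m _; rewrite FF unb 1?eq_sym // subrr mulr0.
  under eq_bigr do rewrite effC mulrDr.
  rewrite big_split /= -mulr_suml sumFD mul0r addr0 (bigD1 n) //= eqxx mul1r.
  rewrite [X in _ + X]big1 ?addr0 1?mulrC // => m mn.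
  by rewrite eq_sym (negPf mn) mul0r mulr0.
have -> : (M%:R * (d%:R - 1)
     + (kappa%:C * d%:R - 1) * (\tr (rho *m rho) * d%:R - 1))
    / (d%:R * (d%:R - 1)) = lambda * \tr (D *m D) + M%:R / d%:R.
  rewrite trM // /lambda; field; exact/andP.
have -> : \sum_b \sum_n \tr (P b n *m rho) ^+ 2
    = \sum_i \tr (F i *m D) ^+ 2 + M%:R / d%:R.
  rewrite -(pair_bigA _ (fun b n => \tr (F (b, n) *m D) ^+ 2)) /=.
  rewrite mulr_natl -[in _ *+ M](card_ord M) -sumr_const -big_split.
  apply: eq_bigr => b _ /=.
  (* Each probability is expanded around its mean [1 / d]. The cross terms cancel by [sumFD], and
     the squared means add up to [1 / d] per measurement. *)
  under eq_bigr => n _.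
    rewrite -[\tr _](subrK d%:R^-1) -(FD (b, n)) sqrrD -addrA.
    over.
  rewrite big_split /= big_split /= sumrMnl -mulr_suml sumFD mul0r mul0rn add0r.
  by rewrite sumr_const card_ord -[_ *+ d in LHS]mulr_natr expr2 mulfVK.
by rewrite lerD2r bessel_gram_eigenvector.
Qed.

Theorem proposition5 (R : realType) (d M : nat) (kappaA kappaB : R)
    (P Q : 'I_M -> 'I_d -> 'M[R[i]]_d) (rhoA rhoB : 'M[R[i]]_d) :
  (2 <= d)%N ->
  mutually_unbiased_measurements kappaA P ->
  mutually_unbiased_measurements kappaB Q ->
  density_matrix rhoA ->
  density_matrix rhoB ->
  correlation_measure P Q (rhoA *t rhoB) <=
    sqrtC ((M%:R * (d%:R - 1)
            + (kappaA%:C * d%:R - 1) * (\tr (rhoA *m rhoA) * d%:R - 1))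
           / (d%:R * (d%:R - 1))) *
    sqrtC ((M%:R * (d%:R - 1)
            + (kappaB%:C * d%:R - 1) * (\tr (rhoB *m rhoB) * d%:R - 1))
           / (d%:R * (d%:R - 1))).
Proof.
move=> d_gt1 mumP mumQ dA dB.
have boundA := mum_index_of_coincidence _ _ _ _ _ _ d_gt1 mumP dA.
have boundB := mum_index_of_coincidence _ _ _ _ _ _ d_gt1 mumQ dB.
(* As [M] by [d] matrices, the two probability tables have the correlation measure as their inner
   product. *)
pose p := \matrix_(b < M, n < d) \tr (P b n *m rhoA).
pose q := \matrix_(b < M, n < d) \tr (Q b n *m rhoB).
have pR b n : p b n \is Num.real.
  rewrite mxE mxtrace_herm_real ?dA.1.1 //.
  by have [/(_ n)[]] := mum_povm mumP b.
have qR b n : q b n \is Num.real.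
  rewrite mxE mxtrace_herm_real ?dB.1.1 //.
  by have [/(_ n)[]] := mum_povm mumQ b.
have Jpq : correlation_measure P Q (rhoA *t rhoB)
    = dotmx (mxvec p) (mxvec q).
  rewrite dotmx_mxvec; apply: eq_bigr => b _; apply: eq_bigr => n _.
  by rewrite (CrealP (qR b n)) !mxE -mxtrace_tens -tensmx_mul.
have pp : dotmx (mxvec p) (mxvec p) = \sum_b \sum_n \tr (P b n *m rhoA) ^+ 2.
  rewrite dotmx_mxvec; apply: eq_bigr => b _; apply: eq_bigr => n _.
  by rewrite (CrealP (pR b n)) mxE expr2.
have qq : dotmx (mxvec q) (mxvec q) = \sum_b \sum_n \tr (Q b n *m rhoB) ^+ 2.
  rewrite dotmx_mxvec; apply: eq_bigr => b _; apply: eq_bigr => n _.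
  by rewrite (CrealP (qR b n)) mxE expr2.
(* The order on [R[i]] is partial: only a real number can be compared with its modulus, which is
   what Cauchy-Schwarz controls. *)
have JR : dotmx (mxvec p) (mxvec q) \is Num.real.
  rewrite dotmx_mxvec; apply: rpred_sum => b _; apply: rpred_sum => n _.
  by rewrite rpredM ?(CrealP (qR b n)).
rewrite Jpq; apply: le_trans (real_ler_norm JR) _.
apply: le_trans (CauchySchwarz_sqrt _ _ _).1 _.
(* Nonnegativity of the upper bound [y] is inherited from [x], here a squared norm. *)
have sq_le (x y : R[i]) : 0 <= x -> x <= y -> sqrtC x <= sqrtC y.
  by move=> x0 xy; rewrite ler_sqrtC ?nnegrE // (le_trans x0).
rewrite -pp in boundA; rewrite -qq in boundB.
apply: ler_pM; rewrite ?sqrtC_ge0 ?dnorm_ge0 //.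
  exact: sq_le (dnorm_ge0 _ _) boundA.
exact: sq_le (dnorm_ge0 _ _) boundB.
Qed.
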